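(* Let $V$ be a real vector space of finite dimension and let $\|\cdot\|:V\to\mathbb R$ be a Minkowski pseudo-norm. Then: (i) the affine open forward balls $B^+_v(r)=\{x\in V:\|x-v\|<r\}$, $v\in V$, $r>0$ (respectively, the affine open backward balls $B^-_v(r)=\{x\in V:\|v-x\|<r\}$, $v\in V$, $r>0$) constitute a basis for the natural topology of $V$; (ii) if $\|\cdot\|$ is not a Minkowski norm, then the fundamental tensor field $g$ is degenerate at some direction, i.e. there exists $v\in V\setminus\{0\}$ such that the bilinear form $g_v$ is degenerate.
   Context: A Minkowski pseudo-norm on $V$ is a map $\|\cdot\|:V\to\mathbb R$ such that $\|v\|\ge0$ with equality iff $v=0$; $\|\lambda v\|=\lambda\|v\|$ for all $\lambda>0$ and $v\in V$ (only positive homogeneity is required); and $\|\cdot\|$ is $C^\infty$ on $V\setminus\{0\}$. Its fundamental tensor is $g_v(u,w)=\frac{\partial^2}{\partial t\partial s}\frac12\|v+tu+sw\|^2|_{t=s=0}$, for $v\in V\setminus\{0\}$ and $u,w\in V$. It is a Minkowski norm if $g_v$ is positive definite for all $v\in V\setminus\{0\}$. *)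

(* Defs.v *)
From mathcomp Require Import all_boot all_order all_algebra.
From mathcomp Require Import all_classical all_reals all_analysis.

Set Implicit Arguments.
Unset Strict Implicit.
Unset Printing Implicit Defensive.

Import Order.TTheory GRing.Theory Num.Theory.
Import VectorInternalTheory numFieldNormedType.Exports.

Local Open Scope classical_set_scope.
Local Open Scope ring_scope.

(* The natural topology of a finite-dimensional real vector space, transported
   from row vectors by the linear coordinate isomorphism [v2r]; since linear
   automorphisms of R^n are homeomorphisms, the choice of coordinates does not
   matter. *)
Definition natural_space (R : realType) (V : vectType R) : topologicalType :=
  initial_topology (v2r : V -> 'rV[R]_(dim V)).

(* [U] is meant to be open.  On a finite-dimensional [E], [f] is C^(k+1) on [U]
   iff it is differentiable on [U] and each directional derivative is C^k. *)
Fixpoint class_C (R : realType) (E : normedModType R) (k : nat)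
    (U : set E) (f : E -> R) : Prop :=
  match k with
  | 0 => forall x, U x -> {for x, continuous f}
  | k'.+1 => (forall x, U x -> differentiable f x) /\
             (forall v : E, class_C k' U ('D_v f))
  end.

Definition smooth_on (R : realType) (V : vectType R) (U : set V) (f : V -> R) :=
  forall k, class_C k ((@r2v R V) @^-1` U) (f \o @r2v R V).

Record minkowski_pseudo_norm (R : realType) (V : vectType R) (N : V -> R) :
    Prop := MinkowskiPseudoNorm {
  mpn_ge0 : forall v, 0 <= N v;
  mpn_eq0 : forall v, N v = 0 <-> v = 0;
  mpn_homogeneous : forall (l : R) v, 0 < l -> N (l *: v) = l * N v;
  mpn_smooth : smooth_on [set v | v != 0] N
}.

Definition fundamental_tensor (R : realType) (V : vectType R) (N : V -> R)
    (v u w : V) : R :=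
  derive1 (fun t : R =>
    derive1 (fun s : R => 2^-1 * N (v + t *: u + s *: w) ^+ 2) 0) 0.

Definition positive_definite (R : realType) (V : vectType R) (g : V -> V -> R) :=
  forall u, u != 0 -> 0 < g u u.

Definition degenerate (R : realType) (V : vectType R) (g : V -> V -> R) :=
  exists2 u, u != 0 & forall w, g u w = 0.

Definition minkowski_norm (R : realType) (V : vectType R) (N : V -> R) :=
  minkowski_pseudo_norm N /\
  forall v, v != 0 -> positive_definite (fundamental_tensor N v).

Definition forward_ball (R : realType) (V : vectType R) (N : V -> R)
    (v : V) (r : R) : set V := [set x | N (x - v) < r].

Definition backward_ball (R : realType) (V : vectType R) (N : V -> R)
    (v : V) (r : R) : set V := [set x | N (v - x) < r].

(* Main.v *)
(** In coordinates let [F = N^2 / 2] and let [B x u w = D_u (D_w F) x] be its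
    Hessian, which is the fundamental tensor.

    (i) [N] is positively homogeneous, and continuous and positive on the
    compact unit sphere, so [c |x| <= N x <= C |x|] with [c > 0].  The upper
    bound gives continuity at [0], so balls are open; by the lower bound those
    of radius [c e] centred at [x] lie in the coordinate ball of radius [e].

    (ii) [B p] is positive definite at a minimiser [p] of [F] divided by the
    squared Euclidean norm, and homogeneity makes every [B v v v] positive.  If
    [B v u u <= 0] with [u != 0], then [u] and [v] are independent, so [p] is
    joined to [v], possibly through [u], by line segments avoiding the origin.
    Along one of them [B] goes from positive definite to not positive definite,
    and the first form that is not definite is semidefinite with an isotropic
    vector, hence degenerate. *)

Require Import Defs.
From mathcomp Require Import all_boot all_order all_algebra.
From mathcomp Require Import all_classical all_reals all_analysis.
From mathcomp Require Import ring lra.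

Import Order.TTheory GRing.Theory Num.Theory.
Import numFieldNormedType.Exports.
Set Implicit Arguments.
Unset Strict Implicit.
Unset Printing Implicit Defensive.

Local Open Scope classical_set_scope.
Local Open Scope ring_scope.

(** * Derivatives along lines and second differences *)

Lemma derive_line (R : realType) (E : normedModType R) (f : E -> R) (x w : E) :
  derive1 (fun s : R => f (x + s *: w)) 0 = 'D_w f x.
Proof.
rewrite /derive1 /derive.
suff -> : (fun h : R => h^-1 *: (f (x + (h + 0) *: w) - f (x + 0 *: w))) =
    (fun h => h^-1 *: ((f \o shift x) (h *: w) - f x)) by [].
by apply/funext => h /=; rewrite addr0 scale0r addr0 [x + _]addrC.
Qed.

Lemma is_derive_line (R : realType) (E : normedModType R) (f : E -> R)
    (x w : E) (t : R) :
  derivable f (x + t *: w) w ->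
  is_derive t 1 (fun s : R => f (x + s *: w)) ('D_w f (x + t *: w)).
Proof.
have eqq : (fun h : R => h^-1 *: (((fun s : R => f (x + s *: w)) \o shift t)
    h%:A - f (x + t *: w))) = (fun h : R => h^-1 *:
    ((f \o shift (x + t *: w)) (h *: w) - f (x + t *: w))).
  apply/funext => h /=; congr (_ *: (f _ - _)).
  by rewrite [h%:A]mulr1 scalerDl addrCA.
move=> df; apply: DeriveDef; first by rewrite /derivable eqq.
by rewrite /derive eqq.
Qed.

Lemma mean_value_line (R : realType) (E : normedModType R) (f : E -> R)
    (x w : E) (h : R) : 0 <= h ->
  (forall t, 0 <= t <= h -> derivable f (x + t *: w) w) ->
  exists2 t, 0 <= t <= h & f (x + h *: w) - f x = h * 'D_w f (x + t *: w).
Proof.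
move=> h0 df.
have [||t th] := @MVT_segment R (fun s => f (x + s *: w))
    (fun s => 'D_w f (x + s *: w)) 0 h h0.
- move=> t; rewrite in_itv /= => /andP[t0 th].
  by apply: is_derive_line; apply: df; rewrite !ltW.
- apply: derivable_within_continuous => t; rewrite in_itv /= => th.
  by case: (is_derive_line (df t th)).
by rewrite scale0r addr0 subr0 mulrC => ->; exists t.
Qed.

(** The mean value theorem is used twice: on the increment [psi] of [F] in direction [u], as a
    function of the step along [w], and then on ['D_w F] along [u]. *)
Lemma second_difference (R : realType) (E : normedModType R) (F : E -> R)
    (x u w : E) (h : R) : 0 <= h ->
  (forall s t, 0 <= s <= h -> 0 <= t <= h ->
     derivable F (x + s *: u + t *: w) w /\
     derivable ('D_w F) (x + s *: u + t *: w) u) ->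
  exists s t, [/\ 0 <= s <= h, 0 <= t <= h &
    F (x + h *: u + h *: w) - F (x + h *: u) - F (x + h *: w) + F x =
      h ^+ 2 * 'D_u ('D_w F) (x + s *: u + t *: w)].
Proof.
move=> h0 dF.
have hh : 0 <= h <= h by rewrite h0 lexx.
have zh : 0 <= (0 : R) <= h by rewrite h0 lexx.
pose psi s := F (x + h *: u + s *: w) - F (x + s *: w).
pose dpsi s := 'D_w F (x + h *: u + s *: w) - 'D_w F (x + s *: w).
have dpsiP t : 0 <= t <= h -> is_derive t 1 psi (dpsi t).
  move=> th; apply: is_deriveB; apply: is_derive_line.
    exact: (dF h t hh th).1.
  by have := (dF 0 t zh th).1; rewrite scale0r addr0.
have [||t th eqt] := @MVT_segment R psi dpsi 0 h h0.
- move=> t; rewrite in_itv /= => /andP[t0 th].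
  by apply: dpsiP; rewrite !ltW.
- apply: derivable_within_continuous => t; rewrite in_itv /= => th.
  by case: (dpsiP _ th).
have [s sh|s sh eqs] := @mean_value_line R E ('D_w F) (x + t *: w) u h h0.
  by rewrite addrAC; case: (dF s t sh th).
exists s, t; split; [exact: sh|exact: th|].
rewrite [x + s *: u + _]addrAC expr2 -mulrA -eqs [x + t *: w + _]addrAC.
move: eqt; rewrite /psi /dpsi scale0r !addr0 subr0 mulrC => <-; ring.
Qed.

Lemma second_difference_cvg (R : realType) (E : normedModType R) (U : set E)
    (F : E -> R) (x u w : E) : open U -> class_C 2 U F -> U x ->
  h ^- 2 * (F (x + h *: u + h *: w) - F (x + h *: u) - F (x + h *: w) + F x)
    @[h --> 0^'+] --> 'D_u ('D_w F) x.
Proof.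
move=> oU [dF CF] Ux; apply/cvgrPdist_lt => e e0.
have cF : {for x, continuous ('D_u ('D_w F))} by apply: (CF w).2.
have : \forall y \near x, U y /\ `|'D_u ('D_w F) x - 'D_u ('D_w F) y| < e.
  near=> y; split; first by near: y; exact: open_nbhs_nbhs.
  by near: y; exact: (@cvgr_dist_lt _ _ _ _ _ _ _ cF).
move=> /nbhs_ballP[d /= d0 dB].
(* The summand [1] keeps this bound on the displacement per unit of [h] positive when [u] and [w]
   both vanish, so that [d] can be divided by it. *)
have k0 : 0 < `|u| + `|w| + 1 by rewrite ltr_wpDl ?addr_ge0.
near=> h.
have h0 : 0 < h by near: h; exact: nbhs_right_gt.
have hd : h * (`|u| + `|w| + 1) < d.
  rewrite -ltr_pdivlMr//; near: h; apply: nbhs_right_lt; exact: divr_gt0.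
have inB s t : 0 <= s <= h -> 0 <= t <= h -> ball x d (x + s *: u + t *: w).
  move=> /andP[s0 sh] /andP[t0 th]; rewrite -ball_normE /=.
  rewrite -addrA opprD addNKr normrN.
  apply: le_lt_trans (ler_normD _ _) _; apply: le_lt_trans hd.
  rewrite !normrZ (ger0_norm s0) (ger0_norm t0) !mulrDr mulr1.
  by rewrite -[leLHS]addr0 !lerD ?ler_wpM2r// ltW.
have [|s [t [sh th ->]]] := @second_difference R E F x u w h (ltW h0).
  move=> s t sh th; have [Uy _] := dB _ (inB s t sh th).
  split; apply: diff_derivable; [exact: dF|exact: (CF w).1].
rewrite mulKf ?expf_neq0 ?gt_eqF//.
by have [] := dB _ (inB s t sh th).
Unshelve. all: by end_near. Qed.

(** * The Hessian of a C^2 function as a symmetric bilinear form *)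

Section SecondDerivative.
Variables (R : realType) (E : normedModType R) (U : set E) (F : E -> R).
Hypotheses (oU : open U) (CF : class_C 2 U F).

(** The second difference is symmetric in [u] and [w], so both iterated derivatives are limits of
    the same quotient. *)
Lemma deriveC2_sym (x u w : E) : U x ->
  'D_u ('D_w F) x = 'D_w ('D_u F) x.
Proof.
move=> Ux; have c1 := second_difference_cvg (u := u) (w := w) oU CF Ux.
have c2 := second_difference_cvg (u := w) (w := u) oU CF Ux.
apply: (cvg_unique (@norm_hausdorff _ _) c1).
apply: cvg_trans c2; apply: near_eq_cvg; apply: nearW => h.
rewrite [x + _ + _]addrAC; congr (_ * (_ + _)).
exact: addrAC.
Qed.

Lemma deriveC2_linearl (x w : E) (a : R) (u u' : E) : U x ->
  'D_(a *: u + u') ('D_w F) x = a * 'D_u ('D_w F) x + 'D_u' ('D_w F) x.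
Proof.
move=> Ux; have dD : differentiable ('D_w F) x by apply: (CF.2 w).1.
by rewrite !deriveE// linearP.
Qed.

Lemma deriveC2_linearr (x w : E) (a : R) (u u' : E) : U x ->
  'D_w ('D_(a *: u + u') F) x = a * 'D_w ('D_u F) x + 'D_w ('D_u' F) x.
Proof.
move=> Ux; rewrite (deriveC2_sym w (_ + _) Ux) (deriveC2_linearl _ _ _ _ Ux).
by rewrite (deriveC2_sym w u Ux) (deriveC2_sym w u' Ux).
Qed.

Lemma deriveC2_scale (x u : E) (a : R) : U x ->
  'D_(a *: u) ('D_(a *: u) F) x = a ^+ 2 * 'D_u ('D_u F) x.
Proof.
move=> Ux; have D0 v : 'D_v ('D_0 F) x = 0.
  by rewrite (deriveC2_sym v 0 Ux) derive0.
rewrite -[a *: u]addr0 (deriveC2_linearl _ _ _ _ Ux) derive0.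
by rewrite (deriveC2_linearr _ _ _ _ Ux) D0 !addr0 mulrA.
Qed.

(** For the directions [u] and [- u] the mixed second difference is minus the centred one and its
    limit is [- 'D_u ('D_u F) x]; the bound passes to the limit. *)
Lemma deriveC2_ge (x u : E) (m : R) : U x ->
  (\forall h \near 0^'+,
     m * h ^+ 2 <= F (x + h *: u) + F (x - h *: u) - 2 * F x) ->
  m <= 'D_u ('D_u F) x.
Proof.
move=> Ux lb.
have c1 := second_difference_cvg (u := u) (w := - u) oU CF Ux.
have e : 'D_u ('D_(- u) F) x = - 'D_u ('D_u F) x.
  have := deriveC2_linearr u (-1) u 0 Ux.
  by rewrite addr0 scaleN1r (deriveC2_sym u 0 Ux) derive0 addr0 mulN1r.
rewrite e in c1.
rewrite -lerN2; apply: (@closed_cvg _ _ _ _ _ (fun y => y <= - m)) c1.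
  exact: closed_le.
near=> h.
have h0 : 0 < h by near: h; exact: nbhs_right_gt.
rewrite ler_pdivrMl ?exprn_gt0// scalerN addrK.
have : m * h ^+ 2 <= F (x + h *: u) + F (x - h *: u) - 2 * F x by near: h.
rewrite mulrC mulrN.
move: (F _) (F _) (F _) (_ * _) => *; lra.
Unshelve. all: by end_near. Qed.

End SecondDerivative.

(** * Paths of symmetric bilinear forms *)

Lemma continuous_sum (R : numFieldType) (T : topologicalType) (I : finType)
    (f : I -> T -> R) :
  (forall i, continuous (f i)) -> continuous (fun x => \sum_i f i x).
Proof.
move=> fc x; elim: (index_enum I) => [|i r IH].
  by under eq_fun do rewrite big_nil; exact: cvg_cst.
under eq_fun do rewrite big_cons.
by apply: cvgD; [exact: fc|exact: IH].
Qed.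

Section BilinearPath.
Variables (R : realType) (n : nat) (B : R -> 'rV[R]_n -> 'rV[R]_n -> R).
Hypothesis Bsym : forall t u w, B t u w = B t w u.
Hypothesis Blin : forall t a u u' w,
  B t (a *: u + u') w = a * B t u w + B t u' w.
Hypothesis Bcont : forall u w, continuous (fun t => B t u w).

Let B0 t w : B t 0 w = 0.
Proof.
have := Blin t 1 0 0 w; rewrite scaler0 addr0 mul1r => /eqP.
by rewrite -subr_eq subrr => /eqP <-.
Qed.

Let Bscale t a u : B t (a *: u) (a *: u) = a ^+ 2 * B t u u.
Proof.
have Bl v w : B t (a *: v) w = a * B t v w.
  by rewrite -[a *: v]addr0 Blin B0 addr0.
by rewrite Bl Bsym Bl mulrA.
Qed.

Lemma semidefinite_isotropic t u : (forall w, 0 <= B t w w) -> B t u u <= 0 ->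
  forall w, B t u w = 0.
Proof.
move=> psd u0 w; set b := B t u w; set c := B t w w.
have c0 : 0 <= c := psd w.
have H e : 0 <= 2 * e * b + e ^+ 2 * c.
  have := psd (e *: w + u); rewrite Blin [B t w _]Bsym [B t u (_ + _)]Bsym !Blin.
  rewrite [B t w u]Bsym -/b -/c; nra.
have [//|b0] := eqVneq b 0.
have b2 : 0 < b ^+ 2 by rewrite exprn_even_gt0.
(* The quadratic in [e] would be least at [- b / c]; the denominator [c + 1] also covers [c = 0] and
   still makes the value negative. *)
have := H (- b / (c + 1)).
have -> : 2 * (- b / (c + 1)) * b + (- b / (c + 1)) ^+ 2 * c =
   - (b ^+ 2 * (c + 2)) / (c + 1) ^+ 2 by field; lra.
rewrite pmulr_lge0 ?invr_gt0 ?exprn_gt0 ?ltr_wpDl// oppr_ge0 leNgt.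
by rewrite mulr_gt0// ltr_wpDl.
Qed.

(** Turns continuity in [t] of each single entry into joint continuity in [t] and [u]. *)
Let Bexpand t u : B t u u =
  \sum_i \sum_j u 0 i * u 0 j * B t (delta_mx 0 i) (delta_mx 0 j).
Proof.
have Bsum v : forall w, B t v w = \sum_i v 0 i * B t (delta_mx 0 i) w.
  move=> w; rewrite {1}[v]row_sum_delta.
  elim/big_rec2: _ => [|i y1 y2 _ <-]; [exact: B0|exact: Blin].
rewrite Bsum; apply: eq_bigr => i _; rewrite Bsym Bsum mulr_sumr.
by apply: eq_bigr => j _; rewrite mulrA [B t _ (delta_mx 0 i)]Bsym.
Qed.

Let Bdiag_continuous : continuous (fun p : R * 'rV[R]_n => B p.1 p.2 p.2).
Proof.
under eq_fun do rewrite Bexpand.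
apply: continuous_sum => i; apply: continuous_sum => j p.
have cc k : {for p, continuous (fun q : R * 'rV[R]_n => q.2 0 k)}.
  by apply: (@continuous_comp _ _ _ snd (fun u : 'rV[R]_n => u 0 k));
    [exact: cvg_snd|exact: differentiable_continuous (differentiable_coord _ 0 k)].
apply: cvgM; first by apply: cvgM; exact: cc.
apply: (@continuous_comp _ _ _ fst (fun t => B t _ _)); first exact: cvg_fst.
exact: Bcont.
Qed.

Lemma unit_sphere_compact : compact [set u : 'rV[R]_n | `|u| = 1].
Proof.
apply: bounded_closed_compact.
  by exists 1; split => // M M1 u /= ->; exact: ltW.
apply: (@preimage_closed _ _ (fun u : 'rV[R]_n => `|u|) [set 1]).
  by move=> u _; exact: norm_continuous.
exact: closed_eq.
Qed.

(* At the first parameter where [B t] has a nonpositive direction, [B t] is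
   still semidefinite as a limit of positive definite forms, so that direction
   lies in its kernel. *)
Lemma path_degenerate : (forall u, u != 0 -> 0 < B 0 u u) ->
  (exists2 u, u != 0 & B 1 u u <= 0) ->
  exists t u, u != 0 /\ forall w, B t u w = 0.
Proof.
move=> pos0 [u1 u1n Bu1].
(* Restricting to unit vectors makes the set of bad pairs compact, so the least bad parameter is
   attained. *)
pose K := (`[0 : R, 1]%classic `*` [set u : 'rV[R]_n | `|u| = 1]) `&`
  [set p | B p.1 p.2 p.2 <= 0].
have normal t u : u != 0 -> B t u u <= 0 ->
    `|(`|u|^-1 *: u)| = 1 /\ B t (`|u|^-1 *: u) (`|u|^-1 *: u) <= 0.
  move=> un Bu; split; first by rewrite normrZ normfV normr_id mulVf// normr_eq0.
  by rewrite Bscale pmulr_rle0// exprn_gt0// invr_gt0 normr_gt0.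
have cK : compact K.
  apply: compact_closedI.
    apply: compact_setX; [exact: segment_compact|exact: unit_sphere_compact].
  apply: (@preimage_closed _ _ (fun p : R * 'rV[R]_n => B p.1 p.2 p.2)
    [set x | x <= 0]) => [p _|]; [exact: Bdiag_continuous|exact: closed_le].
have K0 : K !=set0.
  have [nu Bu] := normal 1 u1 u1n Bu1.
  by exists (1, `|u1|^-1 *: u1); split => //; split => //=; rewrite in_itv /= ler01 lexx.
have cfst : {within K, continuous (fst : R * 'rV[R]_n -> R)}.
  by apply: continuous_subspaceT => p; exact: cvg_fst.
have [[t u] /set_mem[[/= t01 nu] Btu] tmin] := compact_EVT_min K0 cK cfst.
have un : u != 0 by rewrite -normr_gt0 nu.
move: t01; rewrite in_itv /= => /andP[t0 t1].
have {}t0 : 0 < t.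
  rewrite lt_neqAle t0 andbT; apply: contraTneq Btu => <-.
  by rewrite -ltNge; exact: pos0.
exists t, u; split=> //; apply: semidefinite_isotropic => // w.
(* A negative value at [t] would persist slightly to the left of [t], against its minimality;
   [0 < t] keeps those parameters inside the interval. *)
rewrite leNgt; apply/negP => Bw.
have wn : w != 0 by apply: contraTneq Bw => ->; rewrite B0 ltxx.
have : \forall s \near t^'-, B s w w < 0.
  have /cvg_at_left_filter c := @Bcont w w t.
  by apply: (cvgr_lt _ c).
move=> nB.
near (t^'-) => s.
have [nw Bw'] : `|(`|w|^-1 *: w)| = 1 /\ B s (`|w|^-1 *: w) (`|w|^-1 *: w) <= 0.
  by apply: normal => //; apply: ltW; near: s.
have st : s < t by near: s; exact: nbhs_left_lt.
have s0 : 0 < s by near: s; exact: nbhs_left_gt.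
have /tmin /= : (s, `|w|^-1 *: w) \in K.
  apply/mem_set; split => //; split => //=.
  by rewrite in_itv /= ltW// (le_trans (ltW st)).
by rewrite leNgt st.
Unshelve. all: by end_near. Qed.

End BilinearPath.

(** * The half square of a C^2 function *)

(** The first-order expansion of [f] at [x] is also one of [g]. This serves for derivatives whose
    formula is known only on an open set. *)
Lemma near_eq_differentiable (R : numFieldType) (V W : normedModType R)
    (f g : V -> W) (x : V) :
  (\forall y \near x, f y = g y) -> differentiable f x -> differentiable g x.
Proof.
move=> fg df.
have o : g \o shift x = cst (g x) + 'd f x +o_ 0 id.
  apply/eqaddoP => e e0.
  have /eqaddoP/(_ e e0) := diff_locally df.
  have : \forall y \near 0, (f \o shift x) y = (g \o shift x) y.
    by move: fg; rewrite (near_shift 0 x) subr0.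
  apply: filterS2 => y /= fgy.
  by rewrite /= !fctE /= fgy (nbhs_singleton fg).
apply/diff_locallyP; suff -> : 'd g x = 'd f x :> (V -> W).
  by split=> //; exact: diff_continuous.
by apply: diff_unique => //; exact: diff_continuous.
Qed.

(** On [U] the product rule gives ['D_w F = f * 'D_w f], and a second use gives
    [f * 'D_u ('D_w f) + 'D_w f * 'D_u f], whose factors are all continuous there. *)
Lemma class_C2_half_sqr (R : realType) (E : normedModType R) (U : set E)
    (f : E -> R) : open U -> class_C 2 U f ->
  class_C 2 U (fun x => 2^-1 * f x ^+ 2).
Proof.
move=> oU [df Cf].
pose F x := 2^-1 * f x ^+ 2; change (class_C 2 U F).
have nearU x (P : E -> Prop) : U x -> (forall y, U y -> P y) ->
    \forall y \near x, P y.
  by move=> Ux UP; apply: filterS UP _; exact: open_nbhs_nbhs.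
have FE : F = 2^-1 \*: (f * f) by apply/funext.
have dF x : U x -> differentiable F x.
  move=> Ux; rewrite FE; apply: differentiableZ.
  by apply: differentiableM; exact: df.
have DF w x : U x -> 'D_w F x = f x * 'D_w f x.
  move=> Ux; have dfx : derivable f x w by apply: diff_derivable; exact: df.
  rewrite FE deriveZ; last exact: derivableM.
  have half (a : R) : 2^-1 * (a + a) = a by field.
  by rewrite (deriveM dfx dfx); exact: half.
have ddF w x : U x -> differentiable (f * 'D_w f) x.
  by move=> Ux; apply: differentiableM; [exact: df|exact: (Cf w).1].
split=> [//|w]; split=> [x Ux|u x Ux].
  apply: near_eq_differentiable (ddF w x Ux).
  by apply: nearU Ux _ => y Uy; rewrite DF.
have DDF y : U y ->
    f y * 'D_u ('D_w f) y + 'D_w f y * 'D_u f y = 'D_u ('D_w F) y.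
  move=> Uy; transitivity ('D_u (f * 'D_w f) y).
    have d1 : derivable f y u by apply: diff_derivable; exact: df.
    have d2 : derivable ('D_w f) y u by apply: diff_derivable; exact: (Cf w).1.
    by rewrite (deriveM d1 d2).
  by apply: near_eq_derive; apply: nearU Uy _ => z Uz; rewrite DF.
suff : 'D_u ('D_w F) y @[y --> x] -->
    f x * 'D_u ('D_w f) x + 'D_w f x * 'D_u f x by rewrite (DDF _ Ux).
apply: (@cvg_trans _
  ((fun y => f y * 'D_u ('D_w f) y + 'D_w f y * 'D_u f y) @ x)).
  by apply: near_eq_cvg; apply: nearU Ux _ => y Uy; rewrite -DDF.
apply: cvgD; apply: cvgM.
- exact: differentiable_continuous (df _ Ux).
- exact: (Cf w).2.
- exact: differentiable_continuous ((Cf w).1 _ Ux).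
- exact: differentiable_continuous ((Cf u).1 _ Ux).
Qed.

(** * Lines avoiding the origin *)

Lemma segment_avoids0 (R : realType) (E : lmodType R) (x y : E) :
  x != 0 -> (forall c, y <> c *: x) ->
  forall t : R, x + t *: (y - x) != 0 /\ y + t *: (x - y) != 0.
Proof.
move=> x0 xy.
have H t : x + t *: (y - x) != 0.
  apply/eqP => e.
  have [t0|t0] := eqVneq t 0.
    by move: e x0; rewrite t0 scale0r addr0 => ->; rewrite eqxx.
  (* A zero at parameter [t] means [t *: y = (t - 1) *: x]. *)
  apply: (xy (t^-1 * (t - 1))); rewrite -scalerA; apply: (scalerI t0).
  rewrite !scalerA mulVKf// scalerBl scale1r; apply/eqP.
  by rewrite -subr_eq0 -e opprB addrCA scalerBr.
move=> t; split=> //.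
rewrite (_ : y + _ = x + (1 - t) *: (y - x)) ?H//.
by rewrite scalerBl scale1r addrA [x + (y - x)]addrC subrK -scalerN opprB.
Qed.

(** * The squared Euclidean norm *)

Section SumOfSquares.
Variables (R : realType) (n : nat).
Implicit Types x p u : 'rV[R]_n.

(** The norm on row vectors is the maximum norm; this quadratic form serves as comparison function
    because its second differences are explicit. *)
Definition sum_sqr x : R := \sum_i x 0 i ^+ 2.

Lemma sum_sqr_gt0 x : x != 0 -> 0 < sum_sqr x.
Proof.
move=> xn; have ge0 : 0 <= sum_sqr x by apply: sumr_ge0 => i _; exact: sqr_ge0.
rewrite lt_neqAle ge0 andbT eq_sym; apply: contra xn => /eqP e0.
apply/eqP/rowP => i; rewrite mxE; apply/eqP; rewrite -sqrf_eq0.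
have /(_ e0 i isT) -> // := psumr_eq0P (P := predT)
  (F := fun i => x 0 i ^+ 2) (fun i _ => sqr_ge0 _).
Qed.

Lemma sum_sqrZ (a : R) x : sum_sqr (a *: x) = a ^+ 2 * sum_sqr x.
Proof. by rewrite mulr_sumr; apply: eq_bigr => i _; rewrite mxE exprMn. Qed.

Lemma sum_sqr_parallelogram p u :
  sum_sqr (p + u) + sum_sqr (p - u) = 2 * (sum_sqr p + sum_sqr u).
Proof.
rewrite /sum_sqr -!big_split mulr_sumr; apply: eq_bigr => i _ /=.
by rewrite !mxE; ring.
Qed.

Lemma sum_sqr_continuous : continuous sum_sqr.
Proof.
apply: continuous_sum => i; under eq_fun do rewrite expr2.
move=> x; have c : {for x, continuous (fun y : 'rV[R]_n => y 0 i)}.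
  exact: coord_continuous.
exact: (cvgM c c).
Qed.

End SumOfSquares.

(** * Pseudo-norms in coordinates and the Hessian of their half square *)

Section PseudoNorm.
Variables (R : realType) (n : nat) (f : 'rV[R]_n -> R).
Implicit Types x v p q u w : 'rV[R]_n.
Hypothesis f0 : f 0 = 0.
Hypothesis f_gt0 : forall x, x != 0 -> 0 < f x.
Hypothesis fZ : forall (l : R) x, 0 < l -> f (l *: x) = l * f x.
Hypothesis Cf : class_C 2 [set x | x != 0] f.

Let S := [set u : 'rV[R]_n | `|u| = 1].
Let F x := 2^-1 * f x ^+ 2.

Let S_neq0 x : S x -> x != 0.
Proof. by rewrite /S /= -normr_gt0 => ->. Qed.

Let S_normalize x : x != 0 -> S (`|x|^-1 *: x).
Proof. by move=> xn; rewrite /S /= normrZ normfV normr_id mulVf// normr_eq0. Qed.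

Let f_continuousS : {within S, continuous f}.
Proof.
apply: continuous_in_subspaceT => x /set_mem Sx.
exact: differentiable_continuous (Cf.1 _ (S_neq0 Sx)).
Qed.

(** The constants are the extrema of [f] on the compact unit sphere; homogeneity extends the bounds
    to all vectors. *)
Lemma pseudo_norm_equiv : exists c C : R,
  [/\ 0 < c, 0 < C & forall x, c * `|x| <= f x <= C * `|x|].
Proof.
(* In dimension 0 the sphere is empty and there are no extrema; any positive constants do. *)
have [[v vn]|nov] := pselect (exists v : 'rV[R]_n, v != 0); last first.
  exists 1, 1; split => // x; have [->|xn] := eqVneq x 0.
    by rewrite f0 normr0 !mulr0 lexx.
  by case: nov; exists x.
have S0 : S !=set0 by exists (`|v|^-1 *: v); exact: S_normalize.
have cS : compact S := @unit_sphere_compact R n.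
have [p /set_mem Sp pmin] := compact_EVT_min S0 cS f_continuousS.
have [q /set_mem Sq qmax] := compact_EVT_max S0 cS f_continuousS.
exists (f p), (f q); split; [exact/f_gt0/S_neq0|exact/f_gt0/S_neq0|] => x.
have [->|xn] := eqVneq x 0; first by rewrite f0 normr0 !mulr0 lexx.
have xp : 0 < `|x| by rewrite normr_gt0.
have := pmin _ (mem_set (S_normalize xn)).
have := qmax _ (mem_set (S_normalize xn)).
rewrite fZ ?invr_gt0// ler_pdivrMl// [_ * f q]mulrC => ->.
by rewrite ler_pdivlMl// [_ * f p]mulrC => ->.
Qed.

Lemma open_neq0 : open [set x : 'rV[R]_n | x != 0].
Proof.
rewrite (_ : mkset _ = (fun x : 'rV[R]_n => `|x|) @^-1` [set r | 0 < r]).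
  by apply: open_comp; [move=> x _; exact: norm_continuous|exact: open_gt].
by apply/funext => x /=; rewrite normr_gt0.
Qed.

Let CF : class_C 2 [set x | x != 0] F.
Proof. exact: class_C2_half_sqr open_neq0 Cf. Qed.

Let FZ l x : 0 < l -> F (l *: x) = l ^+ 2 * F x.
Proof. by move=> l0; rewrite /F fZ//; ring. Qed.

(* At a minimiser [p] of [F / sum_sqr] the function [F - g p * sum_sqr] is
   nonnegative and vanishes at [p], so its second differences there are
   nonnegative. *)
Lemma hessian_definite_point v : v != 0 ->
  exists2 p, p != 0 & forall u, u != 0 -> 0 < 'D_u ('D_u F) p.
Proof.
move=> vn.
have S0 : S !=set0 by exists (`|v|^-1 *: v); exact: S_normalize.
have cS : compact S := @unit_sphere_compact R n.
pose g x := F x / sum_sqr x.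
have gS : {within S, continuous g}.
  apply: continuous_in_subspaceT => x /set_mem /S_neq0 xn.
  have cF : {for x, continuous F}.
    exact: differentiable_continuous (CF.1 _ xn).
  apply: (cvgM cF).
  by apply: cvgV; [rewrite gt_eqF// sum_sqr_gt0|exact: sum_sqr_continuous].
have [p /set_mem /S_neq0 pn pmin] := compact_EVT_min S0 cS gS.
(* Both sides are homogeneous of degree 2, so minimality on the sphere gives the inequality
   everywhere. *)
have Fge x : g p * sum_sqr x <= F x.
  have [->|xn] := eqVneq x 0.
    have := @sum_sqrZ R n 0 0; rewrite scale0r expr0n mul0r => ->.
    by rewrite mulr0 /F f0 expr0n mulr0.
  rewrite -ler_pdivlMr ?sum_sqr_gt0//.
  have := pmin _ (mem_set (S_normalize xn)).
  have x1 : 0 < `|x|^-1 by rewrite invr_gt0 normr_gt0.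
  by rewrite {2}/g FZ// sum_sqrZ -mulf_div divff ?mul1r// expf_neq0// gt_eqF.
have gp0 : 0 < g p.
  by rewrite divr_gt0 ?sum_sqr_gt0// mulr_gt0 ?invr_gt0// exprn_gt0// f_gt0.
have Fp : F p = g p * sum_sqr p by rewrite divfK// gt_eqF// sum_sqr_gt0.
exists p => // u un.
(* This is the second derivative along [u] of [g p * sum_sqr], read off from the parallelogram
   law. *)
apply: (@lt_le_trans _ _ (2 * g p * sum_sqr u)).
  by rewrite mulr_gt0 ?sum_sqr_gt0// mulr_gt0.
apply: (deriveC2_ge open_neq0 CF pn); near=> h.
have := sum_sqr_parallelogram p (h *: u); rewrite sum_sqrZ.
have := Fge (p + h *: u); have := Fge (p - h *: u); rewrite Fp.
move: (F _) (F _) (g p) (sum_sqr _) (sum_sqr _) (sum_sqr _) (sum_sqr _) => *.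
nra.
Unshelve. all: by end_near. Qed.

(** On the ray through [v], [F] is quadratic, so its centred second difference is exactly
    [2 * F v * h ^+ 2]. *)
Lemma hessian_radial_gt0 v : v != 0 -> 0 < 'D_v ('D_v F) v.
Proof.
move=> vn; apply: (@lt_le_trans _ _ (2 * F v)).
  by rewrite !mulr_gt0 ?invr_gt0 ?exprn_gt0// f_gt0.
apply: (deriveC2_ge open_neq0 CF vn); near=> h.
have h0 : 0 < h by near: h; exact: nbhs_right_gt.
have h1 : h < 1 by near: h; exact: nbhs_right_lt.
have -> : v + h *: v = (1 + h) *: v by rewrite scalerDl scale1r.
have -> : v - h *: v = (1 - h) *: v by rewrite scalerBl scale1r.
rewrite !FZ ?subr_gt0// ?addr_gt0//.
by move: (F v) => Fv; rewrite le_eqVlt; apply/orP; left; apply/eqP; ring.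
Unshelve. all: by end_near. Qed.

(** The Hessians along the line form a continuous path of symmetric bilinear forms, with [p] at
    parameter 0 and [q] at parameter 1. *)
Lemma segment_degenerate p q : (forall t : R, p + t *: (q - p) != 0) ->
  (forall u, u != 0 -> 0 < 'D_u ('D_u F) p) ->
  (exists2 u, u != 0 & 'D_u ('D_u F) q <= 0) ->
  exists2 v, v != 0 & exists2 u, u != 0 & forall w, 'D_u ('D_w F) v = 0.
Proof.
move=> g0 posp [u un qu].
pose B t u w := 'D_u ('D_w F) (p + t *: (q - p)).
have Bsym t u' w : B t u' w = B t w u' := deriveC2_sym open_neq0 CF u' w (g0 t).
have Blin t a u' u'' w : B t (a *: u' + u'') w = a * B t u' w + B t u'' w :=
  deriveC2_linearl CF w a u' u'' (g0 t).
have Bcont u' w : continuous (fun t => B t u' w).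
  move=> t.
  apply: (@continuous_comp _ _ _ (fun t : R => p + t *: (q - p))
    ('D_u' ('D_w F))).
    by apply: cvgD; [exact: cvg_cst|exact: scalel_continuous].
  exact: ((CF.2 w).2 u' _ (g0 t)).
have [||t [u' [un' Bu']]] := path_degenerate Bsym Blin Bcont.
- by move=> u' un'; rewrite /B scale0r addr0; exact: posp.
- have e : p + 1 *: (q - p) = q by rewrite scale1r addrC subrK.
  by exists u; [exact: un|rewrite /B e; exact: qu].
- by exists (p + t *: (q - p)); [exact: g0|exists u'].
Qed.

Lemma indefinite_degenerate v u : v != 0 -> u != 0 -> 'D_u ('D_u F) v <= 0 ->
  exists2 v, v != 0 & exists2 u, u != 0 & forall w, 'D_u ('D_w F) v = 0.
Proof.
move=> vn un uv.
(* For [u = c *: v] the Hessian value would be [c ^+ 2] times the positive radial one. *)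
have vu c : u <> c *: v.
  move=> e; move: uv; rewrite e (deriveC2_scale open_neq0 CF _ _ vn) leNgt.
  rewrite mulr_gt0 ?hessian_radial_gt0// exprn_even_gt0//=.
  by apply: contra un => /eqP c0; rewrite e c0 scale0r.
have [p pn posp] := hessian_definite_point vn.
(* If [p] is a multiple of [v], possibly a negative one, the segment between them may meet the
   origin, so the path goes through [u]. *)
have [[c pc]|npc] := pselect (exists c, p = c *: v); last first.
  have npc' c : p <> c *: v by move=> e; apply: npc; exists c.
  apply: (@segment_degenerate p v) => // [t|]; last by exists u.
  exact: (segment_avoids0 vn npc' t).2.
have pu c' : u <> c' *: p by rewrite pc scalerA.
(* The change of sign happens between [u] and [v] if the Hessian at [u] is positive definite, and
   between [p] and [u] otherwise. *)
have [posu|] := pselect (forall w, w != 0 -> 0 < 'D_w ('D_w F) u).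
  apply: (@segment_degenerate u v) => // [t|]; last by exists u.
  exact: (segment_avoids0 vn vu t).2.
move=> /existsNP[w /not_implyP[wn /negP]]; rewrite -leNgt => wu.
apply: (@segment_degenerate p u) => // [t|]; last by exists w.
exact: (segment_avoids0 pn pu t).1.
Qed.

End PseudoNorm.

(** * Transfer to the vector space and the two conclusions *)

Section Minkowski.
Import VectorInternalTheory.
Variables (R : realType) (V : vectType R) (N : V -> R).
Hypothesis hN : minkowski_pseudo_norm N.

Let f (x : 'rV[R]_(dim V)) : R := N (r2v x).

Let f0 : f 0 = 0.
Proof. by rewrite /f /= linear0; apply/(mpn_eq0 hN). Qed.

Let f_gt0 x : x != 0 -> 0 < f x.
Proof.
move=> xn; rewrite lt_neqAle (mpn_ge0 hN) andbT eq_sym.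
apply: contra xn => /eqP /(mpn_eq0 hN) x0.
by rewrite -[x]r2vK x0 linear0.
Qed.

Let fZ l x : 0 < l -> f (l *: x) = l * f x.
Proof. by move=> l0; rewrite /f /= linearZ (mpn_homogeneous hN). Qed.

Let Cf : class_C 2 [set x | x != 0] f.
Proof.
have := mpn_smooth hN 2; congr (class_C 2 _ _).
apply/funext => x /=; congr (is_true (~~ _)).
by rewrite -(inj_eq (can_inj r2vK)) linear0.
Qed.

(** Smoothness gives this away from the origin only; at the origin it comes from the upper bound
    [C * |x|]. *)
Let f_continuous : continuous f.
Proof.
move=> x; have [x0|xn] := eqVneq x 0; last first.
  exact: differentiable_continuous (Cf.1 _ xn).
have [c [C [_ C0 fC]]] := pseudo_norm_equiv f0 f_gt0 fZ Cf.
have fx0 : f x = 0 by rewrite x0.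
rewrite /continuous_at fx0; apply/(@cvgrPdist_lt _ _ _ _ (nbhs_filter x)) => e e0.
have normx : `|x| < C^-1 * e by rewrite x0 normr0 mulr_gt0 ?invr_gt0.
near=> y; rewrite sub0r normrN ger0_norm; last exact: mpn_ge0 hN _.
have /andP[_ /le_lt_trans] := fC y; apply.
rewrite -ltr_pdivlMl//; near: y.
by apply: (cvgr_lt _ (@norm_continuous _ _ x)).
Unshelve. all: by end_near. Qed.

(** The sign [a] treats both kinds of balls at once: [1] gives the forward and [-1] the backward
    ones. *)
Lemma minkowski_balls_basis (a : R) : `|a| = 1 ->
  @basis (natural_space V)
    [set B | exists (v : V) (r : R),
       0 < r /\ B = [set x | N (a *: (x - v)) < r]].
Proof.
move=> a1; have [c [C [c0 _ fc]]] := pseudo_norm_equiv f0 f_gt0 fZ Cf.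
have ballE v x : N (a *: (x - v)) = f (a *: (v2r x - v2r v)).
  by rewrite /f -linearB -linearZ /= v2rK.
split=> [_ [v [r [r0 ->]]]|x A].
  exists [set y | f (a *: (y - v2r v)) < r].
    apply: (@open_comp _ _ (fun y : 'rV[R]_(dim V) => f (a *: (y - v2r v)))
      [set t | t < r]); last exact: open_lt.
    move=> y _; apply: continuous_comp; last exact: f_continuous.
    apply: (@continuous_comp _ _ _ (fun y : 'rV[R]_(dim V) => y - v2r v)
      ( *:%R a)); last exact: scaler_continuous.
    have id_y : {for y, continuous (fun z : 'rV[R]_(dim V) => z)} by move=> ?.
    by apply: (cvgB id_y); exact: cvg_cst.
  by apply/funext => y /=; rewrite ballE.
rewrite nbhsE => -[W [[P oP <-] Px] WA].
have /nbhs_ballP[e /= e0 eP] : nbhs (v2r x) P by exact: open_nbhs_nbhs.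
exists [set y | N (a *: (y - x)) < c * e].
  split; first by exists x, (c * e); split => //; exact: mulr_gt0.
  by rewrite /= subrr scaler0 (mpn_eq0 hN 0).2 // mulr_gt0.
move=> y /=; rewrite ballE => yc; apply: WA => /=; apply: eP.
rewrite -ball_normE /= distrC -[ltLHS]mul1r -a1 -normrZ -(ltr_pM2l c0).
by apply: le_lt_trans yc; have /andP[] := fc (a *: (v2r y - v2r x)).
Qed.

Lemma forward_balls_basis : @basis (natural_space V)
  [set B | exists (v : V) (r : R), 0 < r /\ B = forward_ball N v r].
Proof.
have := minkowski_balls_basis (normr1 R).
by under eq_fun do under eq_exists do under eq_exists do
  under eq_fun do rewrite scale1r.
Qed.

Lemma backward_balls_basis : @basis (natural_space V)
  [set B | exists (v : V) (r : R), 0 < r /\ B = backward_ball N v r].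
Proof.
have := minkowski_balls_basis (normrN1 R).
by under eq_fun do under eq_exists do under eq_exists do
  under eq_fun do rewrite scaleN1r opprB.
Qed.

(** The inner derivative in [s] is the one along [w], the outer in [t] the one along [u]. *)
Lemma fundamental_tensorE v u w :
  fundamental_tensor N v u w =
  'D_(v2r u) ('D_(v2r w) (fun x => 2^-1 * f x ^+ 2)) (v2r v).
Proof.
rewrite /fundamental_tensor -derive_line; congr (derive1 _ 0); apply/funext => t.
rewrite -derive_line; congr (derive1 _ 0); apply/funext => s.
by rewrite /f /= !linearD !linearZ /= !v2rK.
Qed.

Lemma not_minkowski_degenerate : ~ minkowski_norm N ->
  exists2 v : V, v != 0 & degenerate (fundamental_tensor N v).
Proof.
have v2r0 v : (v2r v != 0) = (v != 0) by rewrite -(inj_eq (can_inj v2rK)) linear0.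
move=> nN; have [v [u [vn [un uv]]]] : exists v u : V, v != 0 /\ u != 0 /\
    fundamental_tensor N v u u <= 0.
  apply: contrapT => H; apply: nN; split=> // v vn u un.
  rewrite ltNge; apply/negP => uv; apply: H.
  by exists v, u.
rewrite -v2r0 in vn; rewrite -v2r0 in un; rewrite fundamental_tensorE in uv.
have [x xn [y yn xy]] := indefinite_degenerate f0 f_gt0 fZ Cf vn un uv.
exists (r2v x); first by rewrite -v2r0 r2vK.
exists (r2v y); first by rewrite -v2r0 r2vK.
by move=> w; rewrite fundamental_tensorE !r2vK.
Qed.

End Minkowski.

Theorem proposition2p16 (R : realType) (V : vectType R) (N : V -> R)
    (hN : minkowski_pseudo_norm N) :
  ((@basis (natural_space V)
      [set B | exists (v : V) (r : R), 0 < r /\ B = forward_ball N v r]) /\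
   (@basis (natural_space V)
      [set B | exists (v : V) (r : R), 0 < r /\ B = backward_ball N v r])) /\
  (~ minkowski_norm N ->
     exists2 v : V, v != 0 & degenerate (fundamental_tensor N v)).
Proof.
split; last exact: not_minkowski_degenerate.
by split; [exact: forward_balls_basis|exact: backward_balls_basis].
Qed.
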